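(* Let $(A,\widetilde{A})$ be a dual pair (i.e. $A,\widetilde{A}$ densely defined, closable, $A\subset\widetilde{A}^*$) of closed operators that has the common core property (there is $\mathcal{D}\subset\mathcal{D}(A)\cap\mathcal{D}(\widetilde{A})$ which is a core for both $A$ and $\widetilde{A}$), where $A$ is dissipative. Let $V:=\frac{A-\widetilde{A}}{2i}\upharpoonright_{\mathcal{D}}$ be the non-negative symmetric ''imaginary part'', and let $V_F$, $V_K$ denote its Friedrichs and Krein--von Neumann extensions. Let $\mathcal{V}\subset\mathcal{D}(\widetilde{A}^* )$ be a linear space with $\mathcal{V}\cap\mathcal{D}(A)=\{0\}$, let $\mathcal{L}:\mathcal{V}\to\mathcal{H}$ be linear, and define $A_{\mathcal{V},\mathcal{L}}$ on $\mathcal{D}(A)\dot{+}\mathcal{V}$ by $A_{\mathcal{V},\mathcal{L}}(f+v)=\widetilde{A}^*(f+v)+\mathcal{L}v$. Assume that $$v\in\mathcal{D}(V_K^{1/2})\qquad\text{and}\qquad \mathcal{L}v\in\operatorname{ran}(V_F^{1/2})=\mathcal{D}(V_F^{-1/2})$$ for all $v\in\mathcal{V}$. Then $A_{\mathcal{V},\mathcal{L}}$ is dissipative if and only if for all $v\in\mathcal{V}$, $$\operatorname{Im}\langle v,(\widetilde{A}^*+\mathcal{L})v\rangle\geq\frac{1}{4}\|\mathcal{U}V_F^{-1/2}\mathcal{L}v+2iV_K^{1/2}v\|^2.$$ Here $V_F^{-1/2}$ is the inverse of $V_F^{1/2}$ as an operator in $\overline{\operatorname{ran}(V_F^{1/2})}$,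 i.e. $V_F^{-1/2}:\operatorname{ran}V_F^{1/2}\to\mathcal{D}(V_F^{1/2})\cap\overline{\operatorname{ran}(V_F^{1/2})}$, $V_F^{1/2}f\mapsto f$, a well-defined non-negative selfadjoint operator on $\overline{\operatorname{ran}(V_F^{1/2})}$; and $\mathcal{U}$ is the partial isometry on $\mathcal{H}$ with $V_K^{1/2}h=\mathcal{U}V_F^{1/2}h$ for all $h\in\mathcal{D}(V_F^{1/2})$, isometric on $\overline{\operatorname{ran}(V_F^{1/2})}$, zero on $\ker V_F^{1/2}$, and with range contained in $\overline{\operatorname{ran}(V_K^{1/2})}$.
   Context: Dissipative means $\operatorname{Im}\langle\psi,A\psi\rangle\geq 0$ for all $\psi$ in the domain; the inner product is antilinear in the first argument. *)

(* Defs.v *)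
From HB Require Import structures.
From mathcomp Require Import all_boot all_order all_algebra.
From mathcomp Require Import boolp classical_sets reals complex.

Set Implicit Arguments.
Unset Strict Implicit.
Unset Printing Implicit Defensive.

Import Order.TTheory GRing.Theory Num.Theory.
Local Open Scope ring_scope.

(* An operator in H: a domain (a predicate on H) together with an action
   (only its values on the domain matter). *)
Record op (H : Type) := Op { dom : H -> Prop ; act : H -> H }.

Section HilbertOperators.
Variable R : realType.
Variable H : lmodType R[i].
Variable ip : H -> H -> R[i].  (* inner product, antilinear in the 1st argument *)

Definition inner_product : Prop :=
  [/\ forall x y z, ip x (y + z) = ip x y + ip x z,
      forall (a : R[i]) x y, ip x (a *: y) = a * ip x y,
      forall x y, ip y x = conjc (ip x y),
      forall x, 0 <= ip x x
    & forall x, ip x x = 0 -> x = 0].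

Definition nsq (x : H) : R := complex.Re (ip x x).

Definition cvg_to (u : nat -> H) (x : H) : Prop :=
  forall e : R, 0 < e -> exists N, forall n, (N <= n)%N -> nsq (u n - x) < e.

Definition cauchy_seq (u : nat -> H) : Prop :=
  forall e : R, 0 < e -> exists N, forall m n, (N <= m)%N -> (N <= n)%N ->
    nsq (u m - u n) < e.

Definition hilbert_space : Prop :=
  inner_product /\ forall u, cauchy_seq u -> exists x, cvg_to u x.

Definition subspace (S : H -> Prop) : Prop :=
  S 0 /\ forall (a : R[i]) x y, S x -> S y -> S (a *: x + y).

Definition in_closure (S : H -> Prop) (x : H) : Prop :=
  forall e : R, 0 < e -> exists y, S y /\ nsq (x - y) < e.

Definition dense (S : H -> Prop) : Prop := forall x, in_closure S x.

Definition op_range (T : op H) (y : H) : Prop := exists x, dom T x /\ act T x = y.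

Definition linear_op (T : op H) : Prop :=
  subspace (dom T) /\
  forall (a : R[i]) x y, dom T x -> dom T y ->
    act T (a *: x + y) = a *: act T x + act T y.

Definition densely_defined (T : op H) : Prop := dense (dom T).

Definition closed_op (T : op H) : Prop :=
  forall (u : nat -> H) x y, (forall n, dom T (u n)) -> cvg_to u x ->
    cvg_to (fun n => act T (u n)) y -> dom T x /\ act T x = y.

Definition extends (T S : op H) : Prop :=
  forall x, dom T x -> dom S x /\ act S x = act T x.

Definition is_adjoint (T Ts : op H) : Prop :=
  (forall y, dom Ts y <-> exists z, forall x, dom T x -> ip (act T x) y = ip x z) /\
  (forall x y, dom T x -> dom Ts y -> ip (act T x) y = ip x (act Ts y)).

Definition selfadjoint (T : op H) : Prop := is_adjoint T T.

Definition dissipative (T : op H) : Prop :=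
  forall x, dom T x -> 0 <= complex.Im (ip x (act T x)).

Definition nonneg_op (T : op H) : Prop :=
  forall x, dom T x -> 0 <= ip x (act T x).

Definition core_for (D : H -> Prop) (T : op H) : Prop :=
  subspace D /\ (forall x, D x -> dom T x) /\
  forall x e, dom T x -> 0 < e ->
    exists y, D y /\ nsq (x - y) + nsq (act T x - act T y) < e.

Definition dual_pair_closed (A At Ats : op H) : Prop :=
  [/\ linear_op A /\ linear_op At, densely_defined A /\ densely_defined At,
      closed_op A /\ closed_op At, is_adjoint At Ats & extends A Ats].

Definition common_core (D : H -> Prop) (A At : op H) : Prop :=
  core_for D A /\ core_for D At.

Definition imag_part (A At : op H) (D : H -> Prop) : op H :=
  Op D (fun x => (2%:R * 'i)^-1 *: (act A x - act At x)).

Definition is_sqrt (S W : op H) : Prop :=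
  [/\ linear_op S, selfadjoint S, nonneg_op S,
      forall x, dom W x <-> (dom S x /\ dom S (act S x))
    & forall x, dom W x -> act W x = act S (act S x)].

Definition nonneg_sa_ext (V W : op H) : Prop :=
  [/\ linear_op W, selfadjoint W, nonneg_op W & extends V W].

(* Friedrichs extension VF of V, with SF = VF^{1/2}: the non-negative selfadjoint
   extension whose form domain D(VF^{1/2}) is the closure of D(V) in the form norm,
   i.e. D(V) is a core for VF^{1/2}. *)
Definition is_friedrichs (V VF SF : op H) : Prop :=
  [/\ nonneg_sa_ext V VF, is_sqrt SF VF & core_for (dom V) SF].

(* Krein--von Neumann extension VK of V, with SK = VK^{1/2}: the smallest
   non-negative selfadjoint extension in the sense of forms. *)
Definition is_krein (V VK SK : op H) : Prop :=
  [/\ nonneg_sa_ext V VK, is_sqrt SK VK &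
      forall W SW, nonneg_sa_ext V W -> is_sqrt SW W ->
        forall x, dom SW x -> dom SK x /\ nsq (act SK x) <= nsq (act SW x)].

Definition partial_iso_FK (SF SK : op H) (U : H -> H) : Prop :=
  [/\ forall (a : R[i]) x y, U (a *: x + y) = a *: U x + U y,
      forall h, dom SF h -> act SK h = U (act SF h),
      forall x, in_closure (op_range SF) x -> nsq (U x) = nsq x,
      forall x, dom SF x -> act SF x = 0 -> U x = 0
    & forall x, in_closure (op_range SK) (U x)].

(* Finv = VF^{-1/2}: VF^{1/2} f |-> f for f in D(VF^{1/2}) ∩ closure(ran VF^{1/2})
   (only its values on ran VF^{1/2} are constrained). *)
Definition inv_sqrt (SF : op H) (Finv : H -> H) : Prop :=
  forall f, dom SF f -> in_closure (op_range SF) f -> Finv (act SF f) = f.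

(* A_{V,L} on D(A) \dot+ V : f + v |-> Ats (f + v) + L v  (the decomposition is
   unique since V ∩ D(A) = {0}) *)
Definition AVL (A Ats : op H) (Vs : H -> Prop) (L : H -> H) : op H :=
  Op (fun x => exists f v, dom A f /\ Vs v /\ x = f + v)
     (fun x => act Ats x + L (xget 0 (fun v => Vs v /\ dom A (x - v)))).

End HilbertOperators.

(* Main.v *)
(** For [f] in [D] and [v] in [Vs], write [p = V_K^(1/2) f = U V_F^(1/2) f] and
    [w = 2 V_K^(1/2) v - i U V_F^(-1/2) L v].  The dual pair relation gives
    [Im <f + v, A_VL (f + v)> = |p + w/2|^2 - |w|^2 / 4 + Im <v, (At^* + L) v>],
    so the bound implies dissipativity, and the converse holds because [-w/2] is
    a limit of vectors [p].  For the part [U V_F^(-1/2) L v] this follows from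
    [D] being a core of [V_F^(1/2)]; for [V_K^(1/2) v] it says that
    [V_K^(1/2) D] is dense in the range of [V_K^(1/2)], which is extracted from
    the minimality of [V_K]: let [T] be the adjoint of the operator
    [V_K^(1/2) f |-> V f] on the closure of [V_K^(1/2) D].  Then [T^* T] is a
    non-negative selfadjoint extension of [V] whose form at [h] is the squared
    norm of the projection of [V_K^(1/2) h] onto that closure. *)

Require Import Defs.
From HB Require Import structures.
From mathcomp Require Import all_boot all_order all_algebra.
From mathcomp Require Import boolp classical_sets reals complex.
From mathcomp Require Import ring lra.
Set Implicit Arguments.
Unset Strict Implicit.
Unset Printing Implicit Defensive.
Import Order.TTheory GRing.Theory Num.Theory.
Local Open Scope ring_scope.

(** * Real sequences that eventually drop below every positive number *)

Section VanishingSequences.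
Variable R : realType.
Implicit Types a b : nat -> R.

(** With no absolute value here, [cvg_to ip u x] is by conversion the vanishing of
    [nsq ip (u n - x)], so convergence proofs become comparisons of real sequences. *)
Definition vanishing a : Prop :=
  forall e : R, 0 < e -> exists N, forall n, (N <= n)%N -> a n < e.

Lemma vanishing_le a b : (forall n, a n <= b n) -> vanishing b -> vanishing a.
Proof.
move=> ab vb e e0; have [N HN] := vb e e0.
by exists N => n /HN; apply: le_lt_trans.
Qed.

Lemma vanishingD a b :
  vanishing a -> vanishing b -> vanishing (fun n => a n + b n).
Proof.
move=> va vb e e0; have e2 : 0 < e / 2 by lra.
have [N HN] := va _ e2; have [M HM] := vb _ e2.
exists (maxn N M) => n; rewrite geq_max => /andP[/HN ? /HM ?]; lra.
Qed.

Lemma vanishingZ c a : 0 <= c -> vanishing a -> vanishing (fun n => c * a n).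
Proof.
(* Dividing by [c + 1] rather than [c] covers [c = 0]. *)
move=> c0 va e e0; have c1 : 0 < c + 1 by lra.
have [N HN] := va (e / (c + 1)) (divr_gt0 e0 c1).
exists N => n /HN; rewrite ltr_pdivlMr // => h.
have [a0|a0] := leP 0 (a n); first by apply: le_lt_trans h; nra.
by apply: le_lt_trans e0; nra.
Qed.

Lemma vanishing_sqr a :
  (forall n, 0 <= a n) -> vanishing a -> vanishing (fun n => a n ^+ 2).
Proof.
move=> a0 va e e0; have s0 : 0 < Num.sqrt e by rewrite sqrtr_gt0.
have [N HN] := va _ s0; exists N => n /HN h.
by rewrite -(sqr_sqrtr (ltW e0)) ltr_pXn2r // nnegrE // ltW.
Qed.

Lemma vanishing_sqrt a : vanishing a -> vanishing (fun n => Num.sqrt (a n)).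
Proof.
move=> va e e0; have [N HN] := va _ (exprn_gt0 2 e0); exists N => n /HN h.
by rewrite -[ltRHS](gtr0_norm e0) -sqrtr_sqr ltr_sqrt // exprn_gt0.
Qed.

Lemma vanishing_cst c : vanishing (fun=> c) -> c <= 0.
Proof.
move=> vc; rewrite leNgt; apply/negP => c0.
by have [N /(_ N (leqnn N))] := vc c c0; rewrite ltxx.
Qed.

Lemma vanishing_inv : vanishing (fun n => n.+1%:R^-1).
Proof.
move=> e e0; exists (Num.trunc e^-1) => n Hn.
rewrite invf_plt ?posrE ?ltr0Sn //.
apply: lt_le_trans (truncnS_gt _) _; by rewrite ler_nat.
Qed.

End VanishingSequences.

(** * Inner product calculus, limits and closures *)

Section InnerProduct.
Local Open Scope complex_scope.
Variables (R : realType) (H : lmodType R[i]) (ip : H -> H -> R[i]).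
Hypothesis ipP : inner_product ip.
Implicit Types (x y z : H) (u v : nat -> H) (S : H -> Prop).

Local Notation r x y := (complex.Re (ip x y)).
Local Notation nsq := (nsq ip).
Local Notation cvg_to := (cvg_to ip).
Local Notation in_closure := (in_closure ip).

Lemma ipDr x y z : ip x (y + z) = ip x y + ip x z.
Proof. by case: ipP. Qed.

Lemma ipZr a x y : ip x (a *: y) = a * ip x y.
Proof. by case: ipP. Qed.

Lemma ipC x y : ip y x = conjc (ip x y).
Proof. by case: ipP. Qed.

Lemma ipDl x y z : ip (y + z) x = ip y x + ip z x.
Proof. by rewrite ipC ipDr (ipC x y) (ipC x z) rmorphD. Qed.

Lemma ipZl a x y : ip (a *: y) x = conjc a * ip y x.
Proof. by rewrite ipC ipZr (ipC x y) rmorphM. Qed.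

Lemma ip0r x : ip x 0 = 0.
Proof. by rewrite -(scale0r 0) ipZr mul0r. Qed.

Lemma ip0l x : ip 0 x = 0.
Proof. by rewrite ipC ip0r rmorph0. Qed.

Lemma ipNr x y : ip x (- y) = - ip x y.
Proof. by rewrite -scaleN1r ipZr mulN1r. Qed.

Lemma ipNl x y : ip (- x) y = - ip x y.
Proof. by rewrite ipC ipNr (ipC y x) rmorphN. Qed.

Definition ipE := (ipDr, ipDl, ipNr, ipNl, ipZr, ipZl, ip0r, ip0l).

Lemma rC x y : r x y = r y x.
Proof. by rewrite (ipC y x); case: (ip y x). Qed.

Lemma rDr x y z : r x (y + z) = r x y + r x z.
Proof. by rewrite ipDr raddfD. Qed.

Lemma rDl x y z : r (y + z) x = r y x + r z x.
Proof. by rewrite ipDl raddfD. Qed.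

Lemma rNr x y : r x (- y) = - r x y.
Proof. by rewrite ipNr raddfN. Qed.

Lemma rNl x y : r (- x) y = - r x y.
Proof. by rewrite ipNl raddfN. Qed.

Lemma rZr (a : R) x y : r x (a%:C *: y) = a * r x y.
Proof. by rewrite ipZr; case: (ip x y) => p q /=; rewrite mul0r subr0. Qed.

Lemma rZl (a : R) x y : r (a%:C *: x) y = a * r x y.
Proof. by rewrite rC rZr rC. Qed.

Lemma r0r x : r x 0 = 0. Proof. by rewrite ip0r. Qed.

Lemma r0l x : r 0 x = 0. Proof. by rewrite ip0l. Qed.

Definition rE := (rDr, rDl, rNr, rNl, rZr, rZl, r0r, r0l).

(** Turns imaginary parts into real parts, so that estimates and limits are only needed for the real
    form [r]. *)
Lemma Im_ip x y : complex.Im (ip x y) = r ('i *: x) y.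
Proof. by rewrite ipZl; case: (ip x y) => p q /=; ring. Qed.

Lemma ri x y : r ('i *: x) y = - r x ('i *: y).
Proof. by rewrite ipZl ipZr; case: (ip x y) => p q /=; ring. Qed.

Lemma ip_eq_r x y x' y' :
  r x y = r x' y' -> r ('i *: x) y = r ('i *: x') y' -> ip x y = ip x' y'.
Proof.
rewrite -!Im_ip; case: (ip x y) => p q; case: (ip x' y') => p' q' /=.
by move=> -> ->.
Qed.

Lemma nsqE x : nsq x = r x x. Proof. by []. Qed.

Lemma ip_nsq x : ip x x = (nsq x)%:C.
Proof.
have [_ _ _ ge0 _] := ipP; have := ge0 x; rewrite nsqE lecE => /andP[/eqP + _].
by case: (ip x x) => p q /= ->.
Qed.

Lemma nsq_ge0 x : 0 <= nsq x.
Proof. by have [_ _ _ ge0 _] := ipP; have := ge0 x; rewrite ip_nsq ler0c. Qed.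

Lemma nsq_eq0 x : nsq x = 0 -> x = 0.
Proof. by move=> h; have [_ _ _ _] := ipP; apply; rewrite ip_nsq h. Qed.

Lemma nsqN x : nsq (- x) = nsq x.
Proof. by rewrite !nsqE !rE opprK. Qed.

Lemma nsqZ a x : nsq (a *: x) = (complex.Re a ^+ 2 + complex.Im a ^+ 2) * nsq x.
Proof. by rewrite nsqE ipZl ipZr ip_nsq; case: a => p q /=; ring. Qed.

Lemma ip_ext x y : (forall z, ip z x = ip z y) -> x = y.
Proof.
move=> h; apply/eqP; rewrite -subr_eq0; apply/eqP/nsq_eq0.
by rewrite /Defs.nsq ipDr ipNr h subrr.
Qed.

Lemma cauchy_schwarz x y : r x y ^+ 2 <= nsq x * nsq y.
Proof.
have [x0|x0] := eqVneq (nsq x) 0.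
  by rewrite (nsq_eq0 x0) r0l expr0n mulr_ge0 ?nsq_ge0.
(* This is [|x|^2] times the part of [y] orthogonal to [x] for the real form; scaling by [|x|^2]
   avoids a division. *)
have := nsq_ge0 ((nsq x)%:C *: y + (- r x y)%:C *: x).
have -> : nsq ((nsq x)%:C *: y + (- r x y)%:C *: x)
        = nsq x * (nsq x * nsq y - r x y ^+ 2).
  by rewrite !nsqE !rE (rC y x); ring.
by rewrite pmulr_rge0 ?subr_ge0 // lt_def x0 nsq_ge0.
Qed.

Definition nrm x := Num.sqrt (nsq x).

Lemma nrm_ge0 x : 0 <= nrm x. Proof. exact: sqrtr_ge0. Qed.

Lemma nrm_sqr x : nrm x ^+ 2 = nsq x.
Proof. by rewrite sqr_sqrtr ?nsq_ge0. Qed.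

Lemma nrm_le x c : 0 <= c -> (nrm x <= c) = (nsq x <= c ^+ 2).
Proof. by move=> c0; rewrite -nrm_sqr ler_pXn2r ?nnegrE ?nrm_ge0. Qed.

Lemma nrm_le_sqrt x c : 0 <= c -> (nrm x <= Num.sqrt c) = (nsq x <= c).
Proof. exact: ler_sqrt. Qed.

Lemma nrm0 : nrm 0 = 0.
Proof. by rewrite /nrm nsqE r0l sqrtr0. Qed.

Lemma normr_r x y : `|r x y| <= nrm x * nrm y.
Proof.
rewrite -(@ler_pXn2r _ 2) ?nnegrE ?mulr_ge0 ?nrm_ge0 //.
by rewrite exprMn !nrm_sqr -normrX ger0_norm ?sqr_ge0 // cauchy_schwarz.
Qed.

Lemma nrmD x y : nrm (x + y) <= nrm x + nrm y.
Proof.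
rewrite nrm_le ?addr_ge0 ?nrm_ge0 // nsqE !rE (rC y x) sqrrD !nrm_sqr -!nsqE.
have := le_trans (ler_norm _) (normr_r x y); lra.
Qed.

Lemma nrmN x : nrm (- x) = nrm x.
Proof. by rewrite /nrm nsqN. Qed.

Lemma nrmZ (a : R) x : 0 <= a -> nrm (a%:C *: x) = a * nrm x.
Proof.
move=> a0; rewrite /nrm nsqZ /= expr0n addr0 sqrtrM ?sqr_ge0 //.
by rewrite sqrtr_sqr ger0_norm.
Qed.

Lemma cvg_nrm u x : cvg_to u x <-> vanishing (fun n => nrm (u n - x)).
Proof.
split=> h; first exact: vanishing_sqrt.
apply: vanishing_le (vanishing_sqr _ h) => n; last exact: nrm_ge0.
by rewrite nrm_sqr.
Qed.

Lemma cvg_le u x (a : nat -> R) :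
  (forall n, nrm (u n - x) <= a n) -> vanishing a -> cvg_to u x.
Proof. by move=> h va; apply/cvg_nrm; exact: vanishing_le h va. Qed.

Lemma cvg_cst x : cvg_to (fun=> x) x.
Proof. by move=> e e0; exists 0%N => n _; rewrite subrr /Defs.nsq ip0r. Qed.

Lemma cvgD u v x y :
  cvg_to u x -> cvg_to v y -> cvg_to (fun n => u n + v n) (x + y).
Proof.
move=> /cvg_nrm ux /cvg_nrm vy; apply: cvg_le (vanishingD ux vy) => n.
by rewrite opprD addrACA nrmD.
Qed.

Lemma cvgZ (a : R[i]) u x : cvg_to u x -> cvg_to (fun n => a *: u n) (a *: x).
Proof.
move=> ux; apply: vanishing_le (vanishingZ _ ux) => [n|].
  by rewrite -scalerBr nsqZ.
by rewrite addr_ge0 ?sqr_ge0.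
Qed.

Lemma cvgN u x : cvg_to u x -> cvg_to (fun n => - u n) (- x).
Proof. by move=> ux e /ux [N HN]; exists N => n /HN; rewrite -opprD nsqN. Qed.

Lemma cvgB u v x y :
  cvg_to u x -> cvg_to v y -> cvg_to (fun n => u n - v n) (x - y).
Proof. by move=> ux /cvgN; exact: cvgD. Qed.

Lemma cvg_eq u v x : (forall n, u n = v n) -> cvg_to u x -> cvg_to v x.
Proof. by move=> uv ux e /ux [N HN]; exists N => n /HN; rewrite uv. Qed.

Lemma cvg_unique u x y : cvg_to u x -> cvg_to u y -> x = y.
Proof.
move=> ux uy; apply/eqP; rewrite -subr_eq0; apply/eqP/nsq_eq0.
apply/eqP; rewrite eq_le nsq_ge0 andbT; apply: vanishing_cst.
apply: vanishing_le (cvgB uy ux) => n.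
by rewrite subrr sub0r nsqN -opprB nsqN.
Qed.

Lemma cvg_r u v x y : cvg_to u x -> cvg_to v y ->
  vanishing (fun n => `|r (u n) (v n) - r x y|).
Proof.
move=> ux vy.
have /(vanishingZ (nrm_ge0 x)) v1 := (cvg_nrm _ _).1 vy.
have /(vanishingZ (nrm_ge0 y)) u1 := (cvg_nrm _ _).1 ux.
apply: vanishing_le (vanishingD (vanishingD v1 u1) (vanishingD ux vy)) => n.
(* The quadratic last term is absorbed by [p q <= p^2 + q^2], which replaces a uniform bound on the
   two sequences. *)
have -> : r (u n) (v n) - r x y =
    r x (v n - y) + r (u n - x) y + r (u n - x) (v n - y) by rewrite !rE; ring.
have := normr_r x (v n - y); have := normr_r (u n - x) y.
have := normr_r (u n - x) (v n - y).
have := nrm_ge0 (u n - x); have := nrm_ge0 (v n - y).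
rewrite -!nrm_sqr; set p := nrm (u n - x); set q := nrm (v n - y) => q0 p0 h1 h2 h3.
have := ler_normD (r x (v n - y) + r (u n - x) y) (r (u n - x) (v n - y)).
have := ler_normD (r x (v n - y)) (r (u n - x) y).
have : p * q <= p ^+ 2 + q ^+ 2 by nra.
lra.
Qed.

Lemma cvg_r_ge u v x y c : cvg_to u x -> cvg_to v y ->
  (forall n, c <= r (u n) (v n)) -> c <= r x y.
Proof.
move=> ux vy h; rewrite -subr_le0; apply: vanishing_cst.
apply: vanishing_le (cvg_r ux vy) => n.
have := h n; have := ler_norm (r (u n) (v n) - r x y); lra.
Qed.

Lemma cvg_r_le u v x y c : cvg_to u x -> cvg_to v y ->
  (forall n, r (u n) (v n) <= c) -> r x y <= c.
Proof.
move=> ux vy h; rewrite -lerN2 -rNr; apply: (cvg_r_ge ux (cvgN vy)) => n.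
by rewrite rNr lerN2.
Qed.

(** Passes identities between inner products to the limit; the imaginary part follows from the real
    one applied to ['i *: u n]. *)
Lemma cvg_ip_eq u v u' v' x y x' y' :
  cvg_to u x -> cvg_to v y -> cvg_to u' x' -> cvg_to v' y' ->
  (forall n, ip (u n) (v n) = ip (u' n) (v' n)) -> ip x y = ip x' y'.
Proof.
have eqr a b a' b' p q p' q' : cvg_to a p -> cvg_to b q -> cvg_to a' p' ->
    cvg_to b' q' -> (forall n, r (a n) (b n) = r (a' n) (b' n)) ->
    r p q = r p' q'.
  move=> ap bq ap' bq' h; apply/eqP; rewrite -subr_eq0 -normr_eq0.
  rewrite eq_le normr_ge0 andbT; apply: vanishing_cst.
  apply: vanishing_le (vanishingD (cvg_r ap bq) (cvg_r ap' bq')) => n.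
  rewrite (h n) [X in _ <= X + _]distrC.
  apply: le_trans (ler_normD _ _).
  by rewrite le_eqVlt; apply/orP; left; apply/eqP; congr `|_|; ring.
move=> ux vy ux' vy' h; apply: ip_eq_r; first by apply: eqr; eauto => n; rewrite h.
apply: (eqr _ _ _ _ _ _ _ _ (cvgZ _ ux) vy (cvgZ _ ux') vy') => n.
by rewrite !ipZl h.
Qed.

Lemma in_closure_seq S x :
  in_closure S x <-> exists2 u, (forall n, S (u n)) & cvg_to u x.
Proof.
split=> [Sx|[u Su ux] e /ux [N HN]]; last first.
  by exists (u N); split=> //; rewrite -opprB nsqN; exact: HN.
have h n : exists y, S y /\ nsq (x - y) < n.+1%:R^-1.
  by apply: Sx; rewrite invr_gt0 ltr0Sn.
have [u Hu] := choice h; exists u => [n|]; first by case: (Hu n).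
apply: vanishing_le (@vanishing_inv R) => n.
by rewrite -opprB nsqN ltW //; case: (Hu n).
Qed.

Lemma cvg_cauchy u x : cvg_to u x -> cauchy_seq ip u.
Proof.
(* The quarter comes from [|a - b|^2 <= 2 |a|^2 + 2 |b|^2]. *)
move=> ux e e0; have e4 : 0 < e / 4 by lra.
have [N HN] := ux _ e4; exists N => m n /HN hm /HN hn.
have -> : u m - u n = (u m - x) - (u n - x) by rewrite opprB addrA subrK.
move: (u m - x) (u n - x) hm hn => a b; have := nsq_ge0 (a + b).
rewrite !nsqE !rE (rC b a) -!nsqE; lra.
Qed.

Lemma sub_in_closure S x : S x -> in_closure S x.
Proof. by move=> Sx; apply/in_closure_seq; exists (fun=> x) => //; exact: cvg_cst. Qed.

Lemma closure_subspace S : subspace S -> subspace (in_closure S).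
Proof.
move=> [S0 SD]; split; first exact: sub_in_closure.
move=> a x y /in_closure_seq [u Su ux] /in_closure_seq [v Sv vy].
apply/in_closure_seq; exists (fun n => a *: u n + v n) => [n|]; first exact: SD.
by apply: cvgD => //; exact: cvgZ.
Qed.

Lemma in_closure_closed S u x :
  (forall n, in_closure S (u n)) -> cvg_to u x -> in_closure S x.
Proof.
move=> Su ux e e0; have e2 : 0 < e / 4 by lra.
have [N HN] := ux _ e2; have [y [Sy hy]] := Su N _ e2.
exists y; split=> //; have {HN} := HN N (leqnn N).
have -> : x - y = (x - u N) + (u N - y) by rewrite addrA subrK.
rewrite -opprB nsqN; move: (x - u N) (u N - y) hy => a b hy.
have := nsq_ge0 (a - b); rewrite !nsqE !rE (rC b a) -!nsqE; lra.
Qed.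

Lemma closure_orth S x z :
  in_closure S x -> (forall y, S y -> ip y z = 0) -> ip x z = 0.
Proof.
move=> /in_closure_seq [u Su ux] h.
rewrite -(ip0r 0); apply: (cvg_ip_eq ux (cvg_cst z) (cvg_cst 0) (cvg_cst 0)) => n.
by rewrite h // ip0r.
Qed.

Lemma dense_orth S z : dense ip S -> (forall y, S y -> ip y z = 0) -> z = 0.
Proof. by move=> /(_ z) dS h; apply: nsq_eq0; rewrite nsqE (closure_orth dS h). Qed.

Lemma subspaceD S x y : subspace S -> S x -> S y -> S (x + y).
Proof. by move=> [_ h] Sx Sy; rewrite -[x]scale1r; exact: h. Qed.

Lemma subspaceZ S a x : subspace S -> S x -> S (a *: x).
Proof. by move=> [S0 h] Sx; rewrite -[_ *: _]addr0; exact: h. Qed.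

Lemma subspaceN S x : subspace S -> S x -> S (- x).
Proof. by move=> sS Sx; rewrite -scaleN1r; exact: subspaceZ. Qed.

Lemma subspaceB S x y : subspace S -> S x -> S y -> S (x - y).
Proof. by move=> sS Sx Sy; apply: subspaceD => //; exact: subspaceN. Qed.

End InnerProduct.

(** * Orthogonal projection and everywhere defined symmetric maps *)

Section Completeness.
Local Open Scope complex_scope.
Variables (R : realType) (H : lmodType R[i]) (ip : H -> H -> R[i]).
Hypothesis hilb : hilbert_space ip.
Implicit Types (x y z : H) (u v : nat -> H) (S : H -> Prop).

Local Notation r x y := (complex.Re (ip x y)).
Local Notation nsq := (nsq ip).
Local Notation nrm := (nrm ip).
Local Notation cvg_to := (cvg_to ip).
Local Notation in_closure := (in_closure ip).
Let ipP : inner_product ip := hilb.1.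

Lemma complete_le u (a : nat -> R) : vanishing a ->
  (forall m n, (m <= n)%N -> nrm (u n - u m) <= a m) -> exists x, cvg_to u x.
Proof.
move=> va h; apply: hilb.2 => e e0.
have s0 : 0 < Num.sqrt e by rewrite sqrtr_gt0.
have [N HN] := va _ s0; exists N => m n Nm Nn.
have lt_e x k : (N <= k)%N -> nrm x <= a k -> nsq x < e.
  move=> Nk hx; rewrite -(nrm_sqr ipP) -(sqr_sqrtr (ltW e0)).
  rewrite ltr_pXn2r // ?nnegrE ?nrm_ge0 ?(ltW s0) //.
  exact: le_lt_trans hx (HN _ Nk).
case: (leqP m n) => [mn|/ltnW mn]; last exact: (lt_e _ n Nn (h _ _ mn)).
by rewrite -opprB (nsqN ipP); exact: (lt_e _ m Nm (h _ _ mn)).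
Qed.

(** [S] need not be closed, so the projection lies in its closure. It is the limit of a sequence in
    [S] minimizing the distance to [x]. *)
Lemma projection S x : subspace S ->
  exists p, in_closure S p /\ forall s, S s -> ip s (x - p) = 0.
Proof.
move=> sS; pose E : set R := fun d => exists2 s, S s & d = nsq (x - s).
have hE : has_inf E.
  split; first by exists (nsq (x - 0)), 0 => //; case: sS.
  by exists 0 => d [s _ ->]; exact: nsq_ge0.
pose d := inf E.
have dle s : S s -> d <= nsq (x - s).
  by move=> Ss; apply: (ge_inf hE.2); exists s.
have exs n : exists s, S s /\ nsq (x - s) < d + n.+1%:R^-1.
  have n0 : 0 < n.+1%:R^-1 :> R by rewrite invr_gt0 ltr0Sn.
  by have [_ [s Ss ->] lt] := inf_adherent n0 hE; exists s.
have [s Hs] := choice exs.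
have [p sp] : exists p, cvg_to s p.
  (* Parallelogram law: [|s n - s m|^2] is twice the sum of the squared distances of [s m] and [s n]
     to [x], minus four times that of their midpoint, which is at least [d]. *)
  apply: (@complete_le s (fun m => Num.sqrt (4 * m.+1%:R^-1))) => [|m n mn].
    by apply: vanishing_sqrt; apply: vanishingZ => //; exact: vanishing_inv.
  rewrite nrm_le_sqrt ?mulr_ge0 ?invr_ge0 //.
  have [Sm Hm] := Hs m; have [Sn Hn] := Hs n.
  have nm : n.+1%:R^-1 <= m.+1%:R^-1 :> R.
    by rewrite lef_pV2 ?posrE ?ltr0Sn // ler_nat.
  have Smid : S ((2^-1)%:C *: (s m + s n)).
    by apply: subspaceZ => //; exact: subspaceD.
  have := dle _ Smid; move: Hm Hn; rewrite !nsqE !(rE ipP).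
  rewrite (rC ipP (s m) x) (rC ipP (s n) x) (rC ipP (s m) (s n)); move: nm.
  move: (m.+1%:R^-1) (n.+1%:R^-1) (r x x) (r x (s m)) (r x (s n)) => ? ? ? ? ?.
  move: (r (s n) (s m)) (r (s n) (s n)) (r (s m) (s m)) (d) => ? ? ? ?; lra.
exists p; split; first by apply/(in_closure_seq ipP); exists s => // n; case: (Hs n).
have orth y : S y -> r y (x - p) = 0.
  move=> Sy; apply/eqP; rewrite -normr_eq0 eq_le normr_ge0 andbT.
  have v0 := vanishing_sqrt (vanishingZ (nsq_ge0 ipP y) (@vanishing_inv R)).
  have v1 := cvg_r ipP (cvg_cst ipP y) (cvgB ipP (cvg_cst ipP x) sp).
  apply: vanishing_cst; apply: vanishing_le (vanishingD v0 v1) => n.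
  rewrite -[X in `|X| <= _](subKr (r y (x - s n))).
  apply: le_trans (ler_normB _ _) _; rewrite lerD2r.
  rewrite -sqrtr_sqr ler_sqrt ?mulr_ge0 ?nsq_ge0 ?invr_ge0 //.
  have [y0|y0] := eqVneq (nsq y) 0.
    by rewrite y0 (nsq_eq0 ipP y0) (r0l ipP) expr0n mul0r.
  have yp : 0 < nsq y by rewrite lt_def y0 nsq_ge0.
  have [Sn Hn] := Hs n; set c := r y (x - s n).
  (* The shift of [s n] along [y] that lowers the distance most gains [c^2 / |y|^2], which
     minimality bounds by [1 / (n + 1)]. *)
  have := dle _ (subspaceD sS Sn (subspaceZ (c / nsq y)%:C sS Sy)).
  rewrite opprD addrA -scaleNr -rmorphN.
  have -> : nsq (x - s n + (- (c / nsq y))%:C *: y) =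
            nsq (x - s n) - c ^+ 2 / nsq y.
    rewrite !nsqE !(rDr ipP _ (x - s n)) !(rDl ipP _ (x - s n)) !(rZl ipP) !(rZr ipP).
    by rewrite (rC ipP (x - s n) y) -/c -!nsqE; field.
  move=> le; rewrite [leRHS]mulrC -ler_pdivrMr //; move: le Hn.
  move: (d) (nsq _) (_ / _) (n.+1%:R^-1) => ? ? ? ?; lra.
move=> y Sy; rewrite -(ip0r ipP 0); apply: (ip_eq_r ipP).
  by rewrite orth // (r0r ipP).
by rewrite orth ?(r0r ipP) //; exact: subspaceZ.
Qed.

(** The residual [x - p] of the projection is orthogonal to [p] and, by assumption, to [x], hence to
    itself. *)
Lemma orth_in_closure S x : subspace S ->
  (forall z, (forall s, S s -> ip s z = 0) -> ip x z = 0) -> in_closure S x.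
Proof.
move=> sS h; have [p [Sp orth]] := projection x sS.
suff -> : x = p by [].
apply/eqP; rewrite -subr_eq0; apply/eqP/(nsq_eq0 ipP).
by rewrite nsqE (ipDl ipP) (ipNl ipP) (h _ orth) (closure_orth ipP Sp orth) subrr.
Qed.

Definition symmetric_map (B : H -> H) := forall x y, ip (B x) y = ip x (B y).

(** Symmetry on the whole space forces linearity: moved to the other argument, [B] no longer acts on
    the sum. *)
Lemma symmetric_linear B (a : R[i]) x y :
  symmetric_map B -> B (a *: x + y) = a *: B x + B y.
Proof.
move=> sB; apply: (ip_ext ipP) => z.
by rewrite -sB !(ipE ipP) !sB.
Qed.

Lemma symmetricZ B (a : R[i]) x : symmetric_map B -> B (a *: x) = a *: B x.
Proof. by move=> sB; apply: (ip_ext ipP) => z; rewrite -sB !(ipE ipP) !sB. Qed.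

Lemma symmetricD B x y : symmetric_map B -> B (x + y) = B x + B y.
Proof. by move=> sB; apply: (ip_ext ipP) => z; rewrite -sB !(ipE ipP) !sB. Qed.

Lemma symmetricB B x y : symmetric_map B -> B (x - y) = B x - B y.
Proof. by move=> sB; apply: (ip_ext ipP) => z; rewrite -sB !(ipE ipP) !sB. Qed.

Definition sa_contraction (B : H -> H) :=
  symmetric_map B /\ forall x, nrm (B x) <= nrm x.

Lemma cvg_contraction B u x :
  sa_contraction B -> cvg_to u x -> cvg_to (fun n => B (u n)) (B x).
Proof.
move=> [sB cB] /(cvg_nrm ipP) ux; apply: (cvg_le ipP) ux => n.
by rewrite -symmetricB.
Qed.

(** * Square roots of bounded operators by iteration *)

Section SquareRoot.
Variable B : H -> H.
Hypothesis BP : sa_contraction B.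

Fixpoint sqrt_iter n x : H :=
  if n is m.+1 then (2^-1)%:C *: (B x + sqrt_iter m (sqrt_iter m x)) else 0.

(** The same iteration for the scalar [B = 1]: it increases to 1 and majorizes [sqrt_iter] and its
    increments. *)
Fixpoint sqrt_bound n : R :=
  if n is m.+1 then (1 + sqrt_bound m ^+ 2) / 2 else 0.

Lemma sqrt_iter_symmetric n : symmetric_map (sqrt_iter n).
Proof.
elim: n => [|n IH] x y /=; first by rewrite (ip0l ipP) (ip0r ipP).
rewrite (ipZl ipP) (ipZr ipP) (ipDl ipP) (ipDr ipP) BP.1 !IH.
by rewrite /= oppr0.
Qed.

(** Each [sqrt_iter n] is a polynomial in [B]. *)
Lemma sqrt_iter_comm n O : symmetric_map O ->
  (forall x, O (B x) = B (O x)) -> forall x, O (sqrt_iter n x) = sqrt_iter n (O x).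
Proof.
move=> sO OB; elim: n => [|n IH] x /=.
  by rewrite -(scale0r 0) (symmetricZ _ _ sO) !scale0r.
by rewrite (symmetricZ _ _ sO) (symmetricD _ _ sO) OB !IH.
Qed.

Lemma sqrt_iter_comm2 m n x :
  sqrt_iter m (sqrt_iter n x) = sqrt_iter n (sqrt_iter m x).
Proof.
apply: sqrt_iter_comm => [|y]; first exact: sqrt_iter_symmetric.
by rewrite -(sqrt_iter_comm _ BP.1).
Qed.

Lemma sqrt_bound_itv n : 0 <= sqrt_bound n <= 1.
Proof. by elim: n => [|n /andP[IH0 IH1]] /=; apply/andP; split; nra. Qed.

Lemma sqrt_bound_gap n : 1 - sqrt_bound n <= 2 * n.+1%:R^-1.
Proof.
(* The sharper bound [2 / (n + 2)] is the one preserved by induction: the gap [s] becomes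
   [s - s^2 / 2]. *)
suff h : (1 - sqrt_bound n) * n.+2%:R <= 2.
  apply: le_trans (_ : 2 * n.+2%:R^-1 <= _).
    by rewrite ler_pdivlMr ?ltr0Sn.
  by rewrite ler_pM2l // lef_pV2 ?posrE ?ltr0Sn // ler_nat.
elim: n => [|n IH] /=; first by lra.
have /andP[t0 t1] := sqrt_bound_itv n.
have -> : n.+3%:R = n.+2%:R + 1 :> R by rewrite -[n.+3]addn1 natrD.
have : 2 <= n.+2%:R :> R by rewrite ler_nat.
move: IH t0 t1; move: n.+2%:R (sqrt_bound n) => k t IH t0 t1 k2.
have -> : 1 - (1 + t ^+ 2) / 2 = (1 - t) - (1 - t) ^+ 2 / 2 by field.
move: IH; set s := 1 - t => IH; have s0 : 0 <= s by rewrite /s; lra.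
have s1 : s <= 1 by rewrite /s; lra.
have [|sk] := leP (s * (k + 1)) 2; first by nra.
nra.
Qed.

Lemma sqrt_iter_le n x : nrm (sqrt_iter n x) <= sqrt_bound n * nrm x.
Proof.
elim: n x => [|n IH] x /=; first by rewrite mul0r (nrm0 ipP).
have /andP[t0 t1] := sqrt_bound_itv n.
rewrite (nrmZ ipP) ?invr_ge0 //.
have := nrmD ipP (B x) (sqrt_iter n (sqrt_iter n x)).
have := BP.2 x; have := IH (sqrt_iter n x); have := IH x.
by have := nrm_ge0 ip x; nra.
Qed.

(** The iterates commute, so a difference of squares factors as the sum times the difference, and
    the scalar increments factor in the same way. *)
Lemma sqrt_iter_step n x :
  nrm (sqrt_iter n.+1 x - sqrt_iter n x) <=
    (sqrt_bound n.+1 - sqrt_bound n) * nrm x.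
Proof.
elim: n x => [|n IH] x.
  by rewrite subr0 subr0; exact: (sqrt_iter_le 1).
have /andP[t0 t1] := sqrt_bound_itv n; have /andP[t0' t1'] := sqrt_bound_itv n.+1.
pose d := sqrt_iter n.+1 x - sqrt_iter n x.
have -> : sqrt_iter n.+2 x - sqrt_iter n.+1 x =
    (2^-1)%:C *: (sqrt_iter n.+1 d + sqrt_iter n d).
  rewrite /d !(symmetricB _ _ (sqrt_iter_symmetric _)).
  rewrite -(sqrt_iter_comm2 n.+1 n) addrA subrK.
  by rewrite [sqrt_iter n.+2 x]/= [in X in _ - X]/= -scalerBr opprD addrACA subrr add0r.
rewrite (nrmZ ipP) ?invr_ge0 //.
have := nrmD ipP (sqrt_iter n.+1 d) (sqrt_iter n d).
have := sqrt_iter_le n.+1 d; have := sqrt_iter_le n d; have := IH x.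
rewrite -/d; have := nrm_ge0 ip x; have := nrm_ge0 ip d.
have -> : sqrt_bound n.+2 = (1 + sqrt_bound n.+1 ^+ 2) / 2 by [].
have : sqrt_bound n.+1 = (1 + sqrt_bound n ^+ 2) / 2 by [].
move: (sqrt_bound n.+1) (sqrt_bound n) t0 t1 t0' t1' => t' t t0 t1 t0' t1' tE.
move: (nrm d) (nrm x) => D X D0 X0 h1 h2 h3 h4.
have : 2^-1 * ((t' + t) * D) <= 2^-1 * ((t' + t) * ((t' - t) * X)).
  by rewrite ler_pM2l ?invr_gt0 //; apply: ler_wpM2l => //; exact: addr_ge0.
have -> : 2^-1 * ((t' + t) * ((t' - t) * X)) = ((1 + t' ^+ 2) / 2 - t') * X.
  by rewrite tE; field.
lra.
Qed.

Lemma sqrt_iter_cauchy m n x : (m <= n)%N ->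
  nrm (sqrt_iter n x - sqrt_iter m x) <= 2 * nrm x * m.+1%:R^-1.
Proof.
move=> /subnKC <-.
apply: (@le_trans _ _ ((sqrt_bound (m + (n - m)) - sqrt_bound m) * nrm x)).
  elim: (n - m)%N => [|k IH]; first by rewrite addn0 !subrr mul0r (nrm0 ipP).
  rewrite addnS; have := sqrt_iter_step (m + k) x.
  have := nrmD ipP (sqrt_iter (m + k).+1 x - sqrt_iter (m + k) x)
                  (sqrt_iter (m + k) x - sqrt_iter m x).
  rewrite addrA subrK; lra.
have /andP[_ h] := sqrt_bound_itv (m + (n - m)).
have := sqrt_bound_gap m; have := nrm_ge0 ip x; move: (m.+1%:R^-1) => ?; nra.
Qed.

(* The iteration is the binomial series of [1 - sqrt (1 - B)]; the limit
   satisfies [Z = (B + Z^2) / 2], that is [(1 - Z)^2 = 1 - B]. *)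
Lemma sqrt_contraction : exists Z : H -> H,
  [/\ sa_contraction Z,
      forall x, Z x + Z x = B x + Z (Z x)
    & forall O, sa_contraction O -> (forall x, O (B x) = B (O x)) ->
        forall x, O (Z x) = Z (O x)].
Proof.
have lim x : exists y, cvg_to (fun n => sqrt_iter n x) y.
  apply: complete_le (fun m n => @sqrt_iter_cauchy m n x).
  by apply: vanishingZ (@vanishing_inv R); rewrite mulr_ge0 ?nrm_ge0.
have [Z HZ] := choice lim; exists Z.
have sZ : symmetric_map Z.
  move=> x y; apply: (cvg_ip_eq ipP (HZ x) (cvg_cst ipP y) (cvg_cst ipP x) (HZ y)).
  by move=> n; exact: sqrt_iter_symmetric.
have cn n x : nrm (sqrt_iter n x) <= nrm x.
  apply: le_trans (sqrt_iter_le n x) _; have /andP[_ h] := sqrt_bound_itv n.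
  by rewrite ler_piMl ?nrm_ge0.
split=> [|x|O OP OB x].
- split=> // x; rewrite (nrm_le ipP) ?nrm_ge0 // nsqE.
  apply: (cvg_r_le ipP (HZ x) (HZ x)) => n.
  by rewrite -nsqE -(nrm_le ipP) ?nrm_ge0.
(* The iterates are contractions uniformly in [n], so pointwise convergence passes to their
   composition. *)
- have ZZ : cvg_to (fun n => sqrt_iter n (sqrt_iter n x)) (Z (Z x)).
    have := vanishingD ((cvg_nrm ipP _ _).1 (HZ x)) ((cvg_nrm ipP _ _).1 (HZ (Z x))).
    apply: (cvg_le ipP) => n.
    have -> : sqrt_iter n (sqrt_iter n x) - Z (Z x) =
        sqrt_iter n (sqrt_iter n x - Z x) + (sqrt_iter n (Z x) - Z (Z x)).
      by rewrite (symmetricB _ _ (sqrt_iter_symmetric n)) addrA subrK.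
    by apply: le_trans (nrmD ipP _ _) _; rewrite lerD2r cn.
  have shift : cvg_to (fun n => sqrt_iter n.+1 x) (Z x).
    by move=> e /(HZ x) [N HN]; exists N => n Nn; apply: HN; exact: leqW.
  have ZE : Z x = (2^-1)%:C *: (B x + Z (Z x)).
    apply: (cvg_unique ipP shift).
    by apply: (cvgZ ipP); apply: (cvgD ipP) ZZ; exact: cvg_cst.
  rewrite {1 2}ZE -scalerDl -rmorphD.
  have -> : 2^-1 + 2^-1 = 1 :> R by field.
  by rewrite rmorph1 scale1r.
- apply: (cvg_unique ipP (cvg_contraction OP (HZ x))).
  apply: (cvg_eq _ (HZ (O x))) => n.
  by rewrite sqrt_iter_comm //; case: OP.
Qed.

End SquareRoot.

(** For a symmetric map this means [0 <= X <= 2], stated so that [sqrt_contraction] applies to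
    [1 - X]. *)
Definition near_identity (X : H -> H) :=
  symmetric_map X /\ forall x, nrm (x - X x) <= nrm x.

Lemma near_identity_contraction X :
  near_identity X -> sa_contraction (fun x => x - X x).
Proof. by move=> [sX cX]; split=> // x y; rewrite !(ipE ipP) sX. Qed.

Lemma near_identity_compl X :
  sa_contraction X -> near_identity (fun x => x - X x).
Proof.
move=> [sX cX]; split=> [x y|x]; first by rewrite !(ipE ipP) sX.
by rewrite subKr.
Qed.

(** Take [G = 1 - Z] with [Z] built from [B = 1 - X]. The commutation clause stands in for a
    functional calculus. *)
Lemma near_identity_sqrt X : near_identity X -> exists G : H -> H,
  [/\ near_identity G, forall x, G (G x) = X x
    & forall O, near_identity O -> (forall x, O (X x) = X (O x)) ->
        forall x, O (G x) = G (O x)].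
Proof.
move=> XP.
have [Z [ZP ZE Zcomm]] := sqrt_contraction (near_identity_contraction XP).
exists (fun x => x - Z x); split=> [|x|O OP OX x].
- exact: near_identity_compl.
- apply: (ip_ext ipP) => z; rewrite (symmetricB _ _ ZP.1).
  have := congr1 (ip z) (ZE x); rewrite !(ipE ipP).
  move: (ip z x) (ip z (Z x)) (ip z (X x)) (ip z (Z (Z x))) => a b c d h.
  have -> : a - b - (b - d) = a + d - (b + b) by ring.
  by rewrite h; ring.
(* [sqrt_contraction] wants a commuting contraction, so it is applied to [1 - O]. *)
- rewrite (symmetricB _ _ OP.1); congr (_ - _).
  have OB y : y - X y - O (y - X y) = y - O y - X (y - O y).
    apply: (ip_ext ipP) => z; rewrite (symmetricB _ _ OP.1) (symmetricB _ _ XP.1).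
    by rewrite OX !(ipE ipP); ring.
  have := Zcomm _ (near_identity_contraction OP) OB x.
  by rewrite (symmetricB _ _ ZP.1) => /addrI/oppr_inj.
Qed.

End Completeness.

(** * Unbounded selfadjoint operators as quotients of bounded ones *)

Section QuotientOperators.
Local Open Scope complex_scope.
Variables (R : realType) (H : lmodType R[i]) (ip : H -> H -> R[i]).
Hypothesis hilb : hilbert_space ip.
Implicit Types (x y z : H) (u v : nat -> H).

Local Notation r x y := (complex.Re (ip x y)).
Local Notation nsq := (nsq ip).
Local Notation nrm := (nrm ip).
Local Notation cvg_to := (cvg_to ip).
Let ipP : inner_product ip := hilb.1.

Lemma selfadjoint_closed T u x y : selfadjoint ip T -> densely_defined ip T ->
  (forall n, dom T (u n)) -> cvg_to u x -> cvg_to (fun n => act T (u n)) y ->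
  dom T x /\ act T x = y.
Proof.
move=> [domT symT] dT Tu ux Ty.
have lim t : dom T t -> ip (act T t) x = ip t y.
  move=> Tt; apply: (cvg_ip_eq ipP (cvg_cst ipP _) ux (cvg_cst ipP _) Ty) => n.
  by rewrite symT.
have Tx : dom T x by apply/domT; exists y.
split=> //; apply/eqP; rewrite -subr_eq0; apply/eqP.
apply: (dense_orth ipP dT) => t Tt.
by rewrite (ipDr ipP) (ipNr ipP) -symT // lim // subrr.
Qed.

(** Used with [x = C y]: it makes both [C] and [1 - C] contractions. *)
Lemma nsq_le_contraction x y : nsq x <= r x y ->
  nsq x <= nsq y /\ nsq (y - x) <= nsq y.
Proof.
have := nsq_ge0 ipP x; have := nsq_ge0 ipP (y - x).
rewrite !nsqE !(rE ipP) (rC ipP y x) => ? ? ?; split; lra.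
Qed.

Lemma symmetric_compl B : symmetric_map ip B -> symmetric_map ip (fun x => x - B x).
Proof. by move=> sB x y; rewrite !(ipE ipP) sB. Qed.

Lemma ip_symmetric_real B x : symmetric_map ip B -> ip x (B x) = (r x (B x))%:C.
Proof.
move=> sB; have := ipC ipP x (B x); rewrite sB; case: (ip x (B x)) => p q [].
by move=> h; congr Complex => /=; lra.
Qed.

Lemma near_identity_nonneg B x : near_identity ip B -> 0 <= ip x (B x).
Proof.
move=> [sB cB]; rewrite ip_symmetric_real // ler0c.
have := cB x; rewrite (nrm_le ipP) ?nrm_ge0 // (nrm_sqr ipP).
have := nsq_ge0 ipP (B x).
rewrite !nsqE !(rE ipP) (rC ipP (B x) x); lra.
Qed.

(* The operator [B A^-1], for [A] injective. *)
Definition quot_op (A B : H -> H) : op H :=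
  Op (fun x => exists a, A a = x) (fun x => B (xget 0 (fun a => A a = x))).

Lemma quot_opE A B a : injective A -> act (quot_op A B) (A a) = B a.
Proof. by move=> injA; congr B; apply: xget_unique => // b /injA. Qed.

Lemma quot_op_linear A B : injective A -> symmetric_map ip A ->
  symmetric_map ip B -> linear_op (quot_op A B).
Proof.
move=> injA sA sB; split=> [|a _ _ [x <-] [y <-]].
  split=> [|a _ _ [x <-] [y <-]].
    by exists 0; rewrite -(scale0r 0) (symmetricZ hilb _ _ sA) !scale0r.
  by exists (a *: x + y); rewrite (symmetric_linear hilb _ _ _ sA).
by rewrite -(symmetric_linear hilb _ _ _ sA) !quot_opE // (symmetric_linear hilb).
Qed.

(* The Bezout identity [P B + Q A = 1] recovers [y = A (P z + Q y)] from
   [B y = A z], i.e. from [y] being in the domain of the adjoint. *)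
Lemma quot_op_selfadjoint A B P Q : injective A ->
  symmetric_map ip A -> symmetric_map ip B ->
  (forall x, A (B x) = B (A x)) -> (forall x, A (P x) = P (A x)) ->
  (forall x, A (Q x) = Q (A x)) ->
  (forall x, P (B x) + Q (A x) = x) -> selfadjoint ip (quot_op A B).
Proof.
move=> injA sA sB AB AP AQ bezout.
have sym a b : ip (B a) (A b) = ip (A a) (B b) by rewrite sB sA AB.
split=> [y|_ _ [a <-] [b <-]]; last by rewrite !quot_opE.
split=> [[b <-]|[z hz]].
  by exists (B b) => _ [a <-]; rewrite quot_opE.
exists (P z + Q y).
have BA : B y = A z.
  apply: (ip_ext ipP) => a; rewrite -sB -sA -hz; last by exists a.
  by rewrite quot_opE.
by rewrite (symmetricD hilb _ _ sA) AP AQ -BA bezout.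
Qed.

Section Resolvent.
Variable C : H -> H.
Hypotheses (Csym : symmetric_map ip C) (Cinj : injective C).
Hypothesis Cfirm : forall x, nsq (C x) <= r (C x) x.

(** The [W] with [C = (1 + W)^-1]. [Cfirm] says [C^2 <= C], which amounts to [W >= 0]. *)
Definition of_resolvent : op H := quot_op C (fun x => x - C x).

Lemma of_resolvent_sa :
  [/\ linear_op of_resolvent, selfadjoint ip of_resolvent
    & nonneg_op ip of_resolvent].
Proof.
have sC' := symmetric_compl Csym.
split; first exact: quot_op_linear.
(* The Bezout identity is [(1 - C) + C = 1]. *)
- apply: (@quot_op_selfadjoint _ _ id id) => // x; last by rewrite subrK.
  by rewrite (symmetricB hilb _ _ Csym).
- move=> _ [x <-]; rewrite quot_opE // (ipDr ipP) (ipNr ipP) (ip_nsq ipP).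
  rewrite Csym ip_symmetric_real // -rmorphB ler0c subr_ge0 -Csym; exact: Cfirm.
Qed.

(* With [W = C^-1 - 1], the square root of [W] is
   [(1 - C)^(1/2) C^(-1/2)], which only needs square roots of bounded operators. *)
Lemma of_resolvent_sqrt : exists S, is_sqrt ip S of_resolvent.
Proof.
have nC : near_identity ip C.
  by split=> // x; rewrite (nrm_le ipP) ?nrm_ge0 // (nrm_sqr ipP);
    case: (nsq_le_contraction (Cfirm x)).
have cC : sa_contraction ip C.
  by split=> // x; rewrite (nrm_le ipP) ?nrm_ge0 // (nrm_sqr ipP);
    case: (nsq_le_contraction (Cfirm x)).
have [G [nG GG Gcomm]] := near_identity_sqrt hilb nC.
have nC' := near_identity_compl hilb cC.
have [F [nF FF Fcomm]] := near_identity_sqrt hilb nC'.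
have GF x : G (F x) = F (G x).
  by apply: Fcomm => // y; rewrite (symmetricB hilb _ _ nG.1) -!GG.
(* [G' = C^(1/4)] serves the non-negativity of [S]: [<G a, F a> = <G' a, F (G' a)>]. *)
have [G' [nG' G'G' G'comm]] := near_identity_sqrt hilb nG.
have FG' x : F (G' x) = G' (F x) by apply: G'comm => // y; rewrite GF.
have Ginj : injective G by move=> x y h; apply: Cinj; rewrite -!GG h.
have FFGG x : F (F x) + G (G x) = x by rewrite FF GG subrK.
pose S := quot_op G F; exists S.
have SE a : act S (G a) = F a by apply: quot_opE.
have SC a : act S (C a) = G (F a) by rewrite -GG SE GF.
have WE a : act of_resolvent (C a) = a - C a by apply: quot_opE.
split.
- by apply: quot_op_linear; [|exact: nG.1|exact: nF.1].
- by apply: (@quot_op_selfadjoint _ _ F G) => //; [exact: nG.1|exact: nF.1].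
- move=> _ [a <-]; rewrite SE -(G'G' a) nG'.1 -FG'.
  exact: near_identity_nonneg.
- move=> x; split=> [[c <-]|[[a <-]]].
    by rewrite SC; split; [exists (G c); rewrite GG|exists (F c)].
  (* From [F a = G b] and [F^2 + G^2 = 1], [a = F (G b) + G (G a) = G (F b + G a)], so [G a] is in
     the range of [C = G^2]. *)
  rewrite SE => -[b hb]; exists (F b + G a).
  by rewrite -GG (symmetricD hilb _ _ nG.1) GF hb FFGG.
- by move=> _ [c <-]; rewrite WE SC SE FF.
Qed.

End Resolvent.
End QuotientOperators.

(** * Images and ranges of linear operators *)

Section LinearOperators.
Variables (R : realType) (H : lmodType R[i]).

Lemma linear_op0 (T : op H) : linear_op T -> act T 0 = 0.
Proof.
move=> [[T0 _] TE]; have := TE (-1) 0 0 T0 T0.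
by rewrite scaler0 addr0 scaleN1r addNr.
Qed.

Lemma image_subspace (T : op H) (S : H -> Prop) : linear_op T -> subspace S ->
  (forall x, S x -> dom T x) -> subspace (fun y => exists2 x, S x & act T x = y).
Proof.
move=> T_lin [S0 SD] ST; split; first by exists 0 => //; exact: linear_op0.
move=> a _ _ [x Sx <-] [y Sy <-]; exists (a *: x + y); first exact: SD.
by apply: T_lin.2; exact: ST.
Qed.

Lemma op_range_subspace (T : op H) : linear_op T -> subspace (op_range T).
Proof.
move=> T_lin; split; first by exists 0; split; [case: T_lin => -[]|exact: linear_op0].
move=> a _ _ [x [Tx <-]] [y [Ty <-]]; exists (a *: x + y).
by split; [exact: T_lin.1.2|exact: T_lin.2].
Qed.

End LinearOperators.

(** * The Hilbert space [H * H], which carries graphs *)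

Section ProductSpace.
Variables (R : realType) (H : lmodType R[i]) (ip : H -> H -> R[i]).
Hypothesis hilb : hilbert_space ip.
Let ipP : inner_product ip := hilb.1.

Definition ip_prod (p q : H * H) : R[i] := ip p.1 q.1 + ip p.2 q.2.

Lemma nsq_prod p : nsq ip_prod p = nsq ip p.1 + nsq ip p.2.
Proof. by rewrite /nsq /ip_prod raddfD. Qed.

Lemma inner_product_prod : inner_product ip_prod.
Proof.
split=> [[x x'] [y y'] [z z']|a [x x'] [y y']|[x x'] [y y']|[x x']|[x x']];
  rewrite /ip_prod /=.
- by rewrite !(ipDr ipP) addrACA.
- by rewrite !(ipZr ipP) mulrDr.
- by rewrite (ipC ipP x y) (ipC ipP x' y') rmorphD.
- by rewrite !(ip_nsq ipP) -rmorphD ler0c addr_ge0 ?nsq_ge0.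
rewrite !(ip_nsq ipP) -rmorphD => /(congr1 (@complex.Re R)) /= /eqP.
rewrite paddr_eq0 ?nsq_ge0 // => /andP[/eqP/(nsq_eq0 ipP) -> /eqP/(nsq_eq0 ipP) ->].
by [].
Qed.

Lemma cvg_prod u p : cvg_to ip_prod u p <->
  cvg_to ip (fun n => (u n).1) p.1 /\ cvg_to ip (fun n => (u n).2) p.2.
Proof.
split=> [up|[u1 u2]]; last first.
  by apply: vanishing_le (vanishingD u1 u2) => n; rewrite nsq_prod.
have h n := nsq_prod (u n - p).
split; apply: vanishing_le up => n; rewrite h.
  by rewrite lerDl nsq_ge0.
by rewrite lerDr nsq_ge0.
Qed.

Lemma hilbert_space_prod : hilbert_space ip_prod.
Proof.
split=> [|u cu]; first exact: inner_product_prod.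
have h m n := nsq_prod (u m - u n).
have [x ux] : exists x, cvg_to ip (fun n => (u n).1) x.
  apply: hilb.2 => e /cu [N HN]; exists N => m n Nm Nn.
  by apply: le_lt_trans (HN m n Nm Nn); rewrite h lerDl nsq_ge0.
have [y uy] : exists y, cvg_to ip (fun n => (u n).2) y.
  apply: hilb.2 => e /cu [N HN]; exists N => m n Nm Nn.
  by apply: le_lt_trans (HN m n Nm Nn); rewrite h lerDr nsq_ge0.
by exists (x, y); apply/cvg_prod.
Qed.

End ProductSpace.

(** * Density of [V_K^(1/2) D] in the range of [V_K^(1/2)] *)

Section KreinForm.
Local Open Scope complex_scope.
Variables (R : realType) (H : lmodType R[i]) (ip : H -> H -> R[i]).
Hypothesis hilb : hilbert_space ip.
Variables (V VK K : op H).
Hypotheses (sD : subspace (dom V)) (dD : dense ip (dom V)).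
Hypothesis krein : is_krein ip V VK K.

Local Notation r x y := (complex.Re (ip x y)).
Local Notation nsq := (nsq ip).
Local Notation ip2 := (ip_prod ip).
Let ipP : inner_product ip := hilb.1.
Let ip2P : inner_product ip2 := inner_product_prod hilb.
Let hilb2 : hilbert_space ip2 := hilbert_space_prod hilb.

Lemma krein_factor f : dom V f ->
  [/\ dom K f, dom K (act K f) & act V f = act K (act K f)].
Proof.
move=> Vf; have [[_ _ _ ext] [_ _ _ domVK actVK] _] := krein.
have [VKf <-] := ext f Vf; have [Kf KKf] := (domVK f).1 VKf.
by rewrite actVK.
Qed.

Let K_lin : linear_op K. Proof. by case: krein => _ []. Qed.
Let K_sym x y : dom K x -> dom K y -> ip (act K x) y = ip x (act K y).
Proof. by case: krein => _ [_ [_ +] _ _ _] _; exact. Qed.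

(** The rotated graph of [K f |-> V f]: orthogonality of [p] to it reads [<V f, p.1> = <K f, p.2>],
    the adjoint relation. *)
Let N (p : H * H) := exists2 f, dom V f & p = (act K (act K f), - act K f).

Let sN : subspace N.
Proof.
have K0 := linear_op0 K_lin; have [_ KE] := K_lin.
split=> [|a _ _ [f Vf ->] [g Vg ->]].
  by exists 0; [case: sD|rewrite !K0 oppr0].
exists (a *: f + g); first by case: sD => _; apply.
have [Kf KKf _] := krein_factor Vf; have [Kg KKg _] := krein_factor Vg.
rewrite KE // KE //; apply: injective_projections => //=.
by rewrite opprD scalerN.
Qed.

Let G (p : H * H) := forall n, N n -> ip2 n p = 0.

(* [E u] is the orthogonal projection of [(u, 0)] onto [G], the closed linear
   relation which is adjoint to [K f |-> V f], [f] in the domain of [V]. *)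
Lemma graph_projection : exists E : H -> H * H,
  (forall u, G (E u)) /\ (forall u p, G p -> ip p.1 u = ip2 p (E u)).
Proof.
have ex u : exists e, G e /\ forall p, G p -> ip p.1 u = ip2 p e.
  have [n [Nn orth]] := projection hilb2 (u, 0) sN.
  exists ((u, 0) - n); split=> // p Gp.
  have -> : ip p.1 u = ip2 p (u, 0) by rewrite /ip_prod /= (ip0r ipP) addr0.
  rewrite (ipDr ip2P) (ipNr ip2P).
  have h := closure_orth ip2P Nn Gp.
  by rewrite (ipC ip2P n p) h rmorph0 oppr0 addr0.
by have [E HE] := choice ex; exists E; split=> u; case: (HE u).
Qed.

(** With T the operator part of [G], [C] is [(1 + T^* T)^-1], [Y] is [T C] and [W] is [T^* T].
    Minimality of [K] against [W] forces [K h = T h], and T takes values in the closure of [K D]. *)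
Lemma krein_range_closure h : dom K h ->
  in_closure ip (fun y => exists2 f, dom V f & act K f = y) (act K h).
Proof.
move=> Kh; have [E [GE projE]] := graph_projection.
pose C u := (E u).1; pose Y u := (E u).2.
have GK f : dom K f -> G (f, act K f).
  move=> Kf _ [g Vg ->]; have [Kg KKg _] := krein_factor Vg.
  by rewrite /ip_prod /= (ipNl ipP) K_sym // subrr.
have Gnsq0 p : ip2 p p = 0 -> p = 0.
  by move=> h0; apply: (nsq_eq0 ip2P); rewrite /Defs.nsq h0.
have GB p q : G p -> G q -> G (p - q).
  by move=> Gp Gq n Nn; rewrite (ipDr ip2P) (ipNr ip2P) Gp // Gq // subrr.
have GZ a p : G p -> G (a *: p).
  by move=> Gp n Nn; rewrite (ipZr ip2P) Gp // mulr0.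
have GD p q : G p -> G q -> G (p + q).
  by move=> Gp Gq n Nn; rewrite (ipDr ip2P) Gp // Gq // addr0.
have E_uniq u e : G e -> (forall p, G p -> ip p.1 u = ip2 p e) -> E u = e.
  move=> Ge he; apply/eqP; rewrite -subr_eq0; apply/eqP/Gnsq0.
  have Gd := GB _ _ (GE u) Ge.
  by rewrite (ipDr ip2P) (ipNr ip2P) -he // -projE // subrr.
have E_lin a u v : E (a *: u + v) = a *: E u + E v.
  apply: E_uniq => [|p Gp]; first exact: GD (GZ _ _ (GE u)) (GE v).
  by rewrite (ipDr ip2P) (ipZr ip2P) -!projE // (ipDr ipP) (ipZr ipP).
(* Hence [C (f + V f) = f], which is what makes [W] extend [V]. *)
have EV f : dom V f -> E (f + act V f) = (f, act K f).
  move=> Vf; have [Kf KKf ->] := krein_factor Vf; apply: E_uniq => [|p Gp].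
    exact: GK.
  have : ip2 (act K (act K f), - act K f) p = 0 by apply: Gp; exists f.
  rewrite /ip_prod /= (ipNl ipP) => /eqP; rewrite subr_eq0 => /eqP KKp.
  rewrite (ipDr ipP); congr (_ + _).
  by rewrite (ipC ipP _ p.1) KKp -(ipC ipP).
have C_sym : symmetric_map ip C.
  by move=> x y; rewrite projE // (ipC ipP (C y) x) projE // -(ipC ip2P).
have C_form u : r (C u) u = nsq (C u) + nsq (Y u).
  by rewrite projE // -nsq_prod.
have C_firm u : nsq (C u) <= r (C u) u by rewrite C_form lerDl nsq_ge0.
(* If [C] kills [x - y], so does [E] by [C_form]; then [x - y] is orthogonal to first components of
   [G], among them the dense domain of [V]. *)
have C_inj : injective C.
  move=> x y Cxy; apply/eqP; rewrite -subr_eq0; apply/eqP.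
  have C0 : C (x - y) = 0 by rewrite (symmetricB hilb _ _ C_sym) Cxy subrr.
  have E0 : E (x - y) = 0.
    by apply: (nsq_eq0 ip2P); rewrite nsq_prod -C_form C0 (r0l ipP).
  apply: (dense_orth ipP dD) => f Vf; have [Kf _ _] := krein_factor Vf.
  by rewrite (projE _ (f, act K f)) ?E0 ?(ip0r ip2P) //; exact: GK.
pose W := of_resolvent C.
have WE u : act W (C u) = u - C u by apply: quot_opE.
have [W_lin W_sa W_nonneg] := of_resolvent_sa hilb C_sym C_inj C_firm.
have W_ext : extends V W.
  move=> f Vf; have CV : C (f + act V f) = f by rewrite /C EV.
  split; first by exists (f + act V f).
  by rewrite -{1}CV WE CV addrC addKr.
have [S Ssqrt] := of_resolvent_sqrt hilb C_sym C_inj C_firm.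
have [S_lin S_sa _ domW actW] := Ssqrt.
have SC u : dom S (C u) by case: ((domW (C u)).1 _) => //; exists u.
have nsq_SC u : nsq (act S (C u)) = nsq (Y u).
  have [_ SSC] := (domW (C u)).1 (ex_intro _ u erefl).
  rewrite nsqE S_sa.2 // -actW; last by exists u.
  by rewrite -/W WE (rDr ipP) (rNr ipP) C_form -nsqE addrAC subrr add0r.
have sE : subspace (fun p => exists u, E u = p).
  split=> [|a _ _ [u <-] [v <-]]; last by exists (a *: u + v); rewrite E_lin.
  exists 0; apply: E_uniq => [n _|q _]; first by rewrite (ip0r ip2P).
  by rewrite (ip0r ip2P) (ip0r ipP).
have [p [Ep orth]] := projection hilb2 (h, act K h) sE.
set q := (h, act K h) - p in orth.
have Gp : G p.
  move=> n Nn; rewrite (ipC ip2P p n) (closure_orth ip2P Ep) ?rmorph0 //.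
  by move=> _ [u <-]; rewrite (ipC ip2P n) GE // rmorph0.
(* As [q] lies in [G], [<q.1, q.1> = <q, E q.1>], and [q] is orthogonal to the range of [E]. *)
have q1 : q.1 = 0.
  have Gq : G q by apply: GB => //; exact: GK.
  apply: (nsq_eq0 ipP); rewrite nsqE projE // (ipC ip2P (E _)) orth ?conjc0 //.
  by exists q.1.
have p1 : p.1 = h by apply/esym/eqP; rewrite -subr_eq0; apply/eqP/q1.
have [e He ep] := (in_closure_seq ip2P _ _).1 Ep.
have [u Hu] := choice He.
have [Cu Yu] := (cvg_prod hilb _ _).1 (cvg_eq (fun n => esym (Hu n)) ep).
(* [S C] and [Y] have equal norms, so [S (C (u n))] is Cauchy along with [Y (u n)]; closedness of
   [S] then puts [h] in its domain. *)
have nsq_p2 : exists2 z, dom S h & act S h = z /\ nsq z = nsq p.2.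
  have [z uz] : exists z, cvg_to ip (fun n => act S (C (u n))) z.
    apply: hilb.2 => d /(cvg_cauchy ipP Yu) [M HM]; exists M => m n Mm Mn.
    have := HM m n Mm Mn; congr (_ < _).
    have YB x y : Y (x - y) = Y x - Y y.
      by rewrite /Y -scaleN1r addrC E_lin /= scaleN1r addrC.
    have SB x y : act S (C (x - y)) = act S (C x) - act S (C y).
      rewrite (symmetricB hilb _ _ C_sym) -scaleN1r addrC.
      by rewrite S_lin.2 // scaleN1r addrC.
    by rewrite -SB nsq_SC YB.
  rewrite -p1; have dS : densely_defined ip S.
    move=> x d d0; have [f [Vf xf]] := dD x d0; exists f; split=> //.
    by have [Wf _] := W_ext f Vf; case: ((domW f).1 Wf).
  have [Sh Shz] := selfadjoint_closed hilb S_sa dS (fun n => SC (u n)) Cu uz.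
  exists z => //; split=> //.
  rewrite !nsqE; congr complex.Re; apply: (cvg_ip_eq ipP uz uz Yu Yu) => n.
  by rewrite !(ip_nsq ipP) nsq_SC.
have [z Sh [Shz zp]] := nsq_p2.
(* Pythagoras gives [|K h|^2 = |p.2|^2 + |q.2|^2], while minimality gives [|K h|^2 <= |p.2|^2]. *)
have Kp : act K h = p.2.
  have [_ _ minK] := krein.
  have [_] := minK W S (And4 W_lin W_sa W_nonneg W_ext) Ssqrt h Sh.
  rewrite Shz zp; have q2 : act K h = p.2 + q.2 by rewrite addrC subrK.
  have pq : ip p.2 q.2 = 0.
    have := closure_orth ip2P Ep orth.
    by rewrite /ip_prod q1 (ip0r ipP) add0r.
  move: (q.2) q2 pq => w -> pq; rewrite !nsqE !(rE ipP) (rC ipP w) pq -!nsqE => le.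
  rewrite (nsq_eq0 ipP (x := w)) ?addr0 //.
  apply/eqP; rewrite eq_le nsq_ge0 // andbT; move: le => /=; lra.
apply: (orth_in_closure hilb) => [|z' orthz].
  by apply: image_subspace K_lin sD _ => f /krein_factor [].
(* Pairing [(0, z')] with [E (u n)] shows [Y (u n)] orthogonal to [z'], hence also its limit
   [K h]. *)
have G0 : G (0, z').
  move=> _ [f Vf ->]; rewrite /ip_prod /= (ip0r ipP) (ipNl ipP) orthz ?oppr0 ?addr0 //.
  by exists f.
rewrite Kp -(ip0r ipP 0).
apply: (cvg_ip_eq ipP Yu (cvg_cst ipP z') (cvg_cst ipP 0) (cvg_cst ipP 0)) => n.
have := projE (u n) _ G0; rewrite /ip_prod /= !(ip0l ipP) add0r => hz.
by rewrite (ipC ipP z') -hz rmorph0.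
Qed.

End KreinForm.

(** * Cores, the inverse of [V_F^(1/2)] and the partial isometry *)

Section FriedrichsKrein.
Local Open Scope complex_scope.
Variables (R : realType) (H : lmodType R[i]) (ip : H -> H -> R[i]).
Hypothesis hilb : hilbert_space ip.
Let ipP : inner_product ip := hilb.1.

Local Notation r x y := (complex.Re (ip x y)).
Local Notation nsq := (nsq ip).
Local Notation cvg_to := (cvg_to ip).
Local Notation in_closure := (in_closure ip).

Lemma core_seq S T x : core_for ip S T -> dom T x ->
  exists u, [/\ forall n, S (u n), cvg_to u x
              & cvg_to (fun n => act T (u n)) (act T x)].
Proof.
move=> [_ [_ core]] Tx.
have ex n : exists y, S y /\ nsq (x - y) + nsq (act T x - act T y) < n.+1%:R^-1.
  by apply: core => //; rewrite invr_gt0 ltr0Sn.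
have [u Hu] := choice ex; exists u.
split=> [n||]; first by case: (Hu n).
  apply: vanishing_le (@vanishing_inv R) => n.
  by rewrite -opprB nsqN // ltW //; case: (Hu n) => _; apply: le_lt_trans;
    rewrite lerDl nsq_ge0.
apply: vanishing_le (@vanishing_inv R) => n.
by rewrite -opprB nsqN // ltW //; case: (Hu n) => _; apply: le_lt_trans;
  rewrite lerDr nsq_ge0.
Qed.

Lemma core_dense S T : core_for ip S T -> densely_defined ip T -> dense ip S.
Proof.
move=> core dT x; have [u Tu ux] := (in_closure_seq ipP _ _).1 (dT x).
apply: (in_closure_closed ipP _ ux) => n; apply/(in_closure_seq ipP).
by have [w [Sw wu _]] := core_seq core (Tu n); exists w.
Qed.

Lemma adjointD T Ts x y : is_adjoint ip T Ts -> densely_defined ip T ->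
  dom Ts x -> dom Ts y -> act Ts (x + y) = act Ts x + act Ts y.
Proof.
move=> [domTs adj] dT Tx Ty.
have Txy : dom Ts (x + y).
  apply/domTs; exists (act Ts x + act Ts y) => t Tt.
  by rewrite !(ipDr ipP) !adj.
apply/eqP; rewrite -subr_eq0; apply/eqP/(dense_orth ipP dT) => t Tt.
by rewrite (ipDr ipP) (ipNr ipP) -adj // !(ipDr ipP) !adj // subrr.
Qed.

(** Any preimage [g] of [y] is projected onto the closure of the range; the residual is orthogonal
    to the range, hence in the kernel of [SF], so [Finv y] is the projection. *)
Lemma inv_sqrt_range SF Finv y : selfadjoint ip SF -> linear_op SF ->
  densely_defined ip SF -> inv_sqrt ip SF Finv -> op_range SF y ->
  [/\ dom SF (Finv y), in_closure (op_range SF) (Finv y)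
    & act SF (Finv y) = y].
Proof.
move=> [domSF symSF] SF_lin dSF inv [g [Sg <-]].
have sran := op_range_subspace SF_lin.
have [p [Rp orth]] := projection hilb g sran.
have Sgp : dom SF (g - p).
  by apply/domSF; exists 0 => x Sx; rewrite (ip0r ipP) orth //; exists x.
have gp0 : act SF (g - p) = 0.
  by apply: (dense_orth ipP dSF) => x Sx; rewrite -symSF // orth //; exists x.
have pE : p = -1 *: (g - p) + g by rewrite scaleN1r opprB subrK.
have Sp : dom SF p by rewrite pE; exact: SF_lin.1.2.
have SFp : act SF p = act SF g by rewrite pE SF_lin.2 // gp0 scaler0 add0r.
by rewrite -SFp inv.
Qed.

Section PartialIsometry.
Variables (SF SK : op H) (U : H -> H) (D : H -> Prop).
Hypotheses (SF_lin : linear_op SF) (UP : partial_iso_FK ip SF SK U).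

Lemma partial_isoB x y : U (x - y) = U x - U y.
Proof.
have [U_lin _ _ _ _] := UP.
by have := U_lin (-1) y x; rewrite !scaleN1r [- y + x]addrC [- U y + _]addrC.
Qed.

(** Polarization of the isometry on the closed range. *)
Lemma partial_iso_ip x y : in_closure (op_range SF) x ->
  in_closure (op_range SF) y -> ip (U x) (U y) = ip x y.
Proof.
have sran := closure_subspace ipP (op_range_subspace SF_lin).
have [U_lin _ U_iso _ _] := UP.
have re p q : in_closure (op_range SF) p -> in_closure (op_range SF) q ->
    r (U p) (U q) = r p q.
  move=> Rp Rq; have := U_iso _ (subspaceB sran Rp Rq); rewrite partial_isoB.
  have := U_iso _ Rp; have := U_iso _ Rq; rewrite !nsqE !(rE ipP).
  rewrite (rC ipP (U q)) (rC ipP q p); lra.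
move=> Rx Ry; apply: (ip_eq_r ipP); first exact: re.
have -> : 'i *: U x = U ('i *: x).
  have U0 : U 0 = 0 by have := partial_isoB 0 0; rewrite !subrr.
  by have := U_lin 'i x 0; rewrite U0 !addr0.
exact: re (subspaceZ _ sran Rx) Ry.
Qed.

(** The core property makes [SF D] dense in the range of [SF], and [U] carries [SF f] isometrically
    to [SK f]. *)
Lemma partial_iso_closure g : core_for ip D SF -> in_closure (op_range SF) g ->
  in_closure (fun y => exists2 f, D f & act SK f = y) (U g).
Proof.
move=> core Rg; have [_ USF U_iso _ _] := UP; have [_ [DSF _]] := core.
have Dg : in_closure (fun y => exists2 f, D f & act SF f = y) g.
  have [u Ru ug] := (in_closure_seq ipP _ _).1 Rg.
  apply: (in_closure_closed ipP _ ug) => n; have [x [Sx <-]] := Ru n.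
  have [w [Dw _ SFw]] := core_seq core Sx.
  by apply/(in_closure_seq ipP); exists (fun n => act SF (w n)) => // k; exists (w k).
have sran := closure_subspace ipP (op_range_subspace SF_lin).
move=> e e0; have [_ [[f Df <-] lt]] := Dg e e0.
exists (act SK f); split; first by exists f.
rewrite USF; last exact: DSF.
rewrite -partial_isoB U_iso //; apply: (subspaceB sran Rg).
by apply: (sub_in_closure ipP); exists f; split=> //; exact: DSF.
Qed.

End PartialIsometry.
End FriedrichsKrein.

(** * The imaginary part of the form for a dual pair *)

Section DualPair.
Variables (R : realType) (H : lmodType R[i]) (ip : H -> H -> R[i]).
Hypothesis ipP : inner_product ip.
Variables (A At Ats : op H).
Hypotheses (adj : is_adjoint ip At Ats) (ext : extends A Ats).
Local Open Scope complex_scope.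
Local Notation r x y := (complex.Re (ip x y)).

(** Here [y] is [V f] and [l] is [L v]. Since [<f, At^* v> = <At f, v>], the cross terms have the
    imaginary part of [<v, (A - At) f> = 2 i <v, y>]. *)
Lemma Im_dual_pair f v l y : dom A f -> dom At f -> dom Ats v ->
  (2 * 'i) *: y = act A f - act At f ->
  complex.Im (ip (f + v) (act A f + act Ats v + l)) =
  r f y + 2 * r v y + complex.Im (ip f l) + complex.Im (ip v (act Ats v + l)).
Proof.
move=> Af Atf Atsv hy.
have [Atsf Atsf_eq] := ext Af.
have ff := adj.2 _ _ Atf Atsf; rewrite Atsf_eq in ff.
have fv := adj.2 _ _ Atf Atsv.
have := congr1 (ip f) hy; have := congr1 (ip v) hy; move: ff fv.
rewrite !(ipE ipP) (ipC ipP f (act At f)) (ipC ipP v (act At f)).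
case: (ip f (act A f)) (ip f (act At f)) (ip f (act Ats v)) (ip v (act At f))
  (ip v (act A f)) (ip f y) (ip v y) (ip f l) (ip v (act Ats v)) (ip v l)
  => [a a'] [b b'] [c c'] [d d'] [e e'] [g g'] [h h'] [k k'] [m m'] [n n'] /=.
case=> E1 E2 [E3 E4] [E5 E6] [E7 E8]; lra.
Qed.

End DualPair.

(** * The dissipativity criterion *)

Unset Implicit Arguments.

Theorem theorem4p4 (R : realType) (H : lmodType R[i]) (ip : H -> H -> R[i])
    (A At Ats : op H) (D : H -> Prop) (VF VK SF SK : op H) (U Finv : H -> H)
    (Vs : H -> Prop) (L : H -> H) :
  hilbert_space ip ->
  dual_pair_closed ip A At Ats ->
  common_core ip D A At ->
  dissipative ip A ->
  is_friedrichs ip (imag_part A At D) VF SF ->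
  is_krein ip (imag_part A At D) VK SK ->
  partial_iso_FK ip SF SK U ->
  inv_sqrt ip SF Finv ->
  subspace Vs ->
  (forall v, Vs v -> dom Ats v) ->
  (forall v, Vs v -> dom A v -> v = 0) ->
  (forall (a : R[i]) v w, Vs v -> Vs w -> L (a *: v + w) = a *: L v + L w) ->
  (forall v, Vs v -> dom SK v /\ op_range SF (L v)) ->
  (dissipative ip (AVL A Ats Vs L) <->
   forall v, Vs v ->
     (4%:R)^-1 * nsq ip (U (Finv (L v)) + (2%:R * 'i) *: act SK v)
       <= complex.Im (ip v (act Ats v + L v))).
Proof.
move=> hilb [[A_lin At_lin] [dA dAt] _ adj ext] [coreA coreAt] _.
move=> friedrichs krein UP invF sVs VsAts VsA _ VsL.
have ipP : inner_product ip := hilb.1.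
have [_ [SF_lin SF_sa _ _ _] coreSF] := friedrichs.
have [_ [SK_lin SK_sa _ _ _] _] := krein.
have [sD [DA _]] := coreA; have [_ [DAt _]] := coreAt.
have [_ [DSF _]] := coreSF.
have dD : dense ip D := core_dense hilb coreA dA.
have dSF : densely_defined ip SF.
  by move=> x e /(dD x) [y [Dy lt]]; exists y; split=> //; exact: DSF.
pose g v := Finv (L v).
(* The vector in the bound is ['i *: w v], of the same norm. *)
pose w v : H := (real_complex R 2) *: act SK v - Complex 0 1 *: U (g v).
have nsq_w v : nsq ip (U (g v) + (2%:R * 'i) *: act SK v) = nsq ip (w v).
  have -> : U (g v) + (2%:R * 'i) *: act SK v = 'i *: w v.
    rewrite /w -[Complex 0 1]/'i scalerBr !scalerA -expr2 sqrCi scaleN1r opprK.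
    by rewrite addrC (mulrC 'i) (rmorph_nat (real_complex R) 2).
  by rewrite nsqZ //= expr0n expr1n add0r mul1r.
have form f v : D f -> Vs v ->
    complex.Im (ip (f + v) (act A f + act Ats v + L v)) =
    nsq ip (act SK f + (real_complex R 2^-1) *: w v) - 4^-1 * nsq ip (w v)
    + complex.Im (ip v (act Ats v + L v)).
  move=> Df Vv; have [SKv LvR] := VsL v Vv.
  have [Sg Rg SFg] := inv_sqrt_range hilb SF_sa SF_lin dSF invF LvR.
  have [SKf SKSKf Vf] := krein_factor krein (Df : dom (imag_part A At D) f).
  have hy : (2 * Complex 0 1) *: act SK (act SK f) = act A f - act At f.
    rewrite -Vf /= scalerA -[Complex 0 1]/'i mulfV ?scale1r //.
    by rewrite mulf_neq0 ?pnatr_eq0 ?neq0Ci.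
  rewrite (Im_dual_pair ipP adj ext _ (DA f Df) (DAt f Df) (VsAts v Vv) hy).
  congr (_ + _).
  rewrite -(SK_sa.2 f) // -(SK_sa.2 v) // -{1}SFg (Im_ip ipP).
  (* [<f, L v> = <SF f, g v> = <SK f, U (g v)>], as [SF f] and [g v] both lie in the closed range
     where [U] is isometric. *)
  have -> : complex.Re (ip (Complex 0 1 *: f) (act SF (Finv (L v)))) =
            - complex.Re (ip (act SK f) (Complex 0 1 *: U (g v))).
    have [_ USF _ _ _] := UP.
    rewrite USF; last exact: DSF.
    rewrite -(ri ipP) -!(Im_ip ipP) (partial_iso_ip hilb SF_lin UP) //.
      by rewrite SF_sa.2 //; exact: DSF.
    by apply: (sub_in_closure ipP); exists f; split=> //; exact: DSF.
  (* The terms linear in [SK f] add up to [Re <SK f, w v>]; the square is then completed. *)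
  have pw : complex.Re (ip (act SK f) (w v)) =
      2 * complex.Re (ip (act SK v) (act SK f))
      - complex.Re (ip (act SK f) (Complex 0 1 *: U (g v))).
    by rewrite (rDr ipP) (rNr ipP) (rZr ipP) (rC ipP (act SK v)).
  move: pw; move: (w v) => x pw.
  by rewrite !nsqE !(rE ipP) (rC ipP x) pw; field.
have actAVL f v : dom A f -> Vs v ->
    act (AVL A Ats Vs L) (f + v) = act A f + act Ats v + L v.
  move=> Af Vv; rewrite /=.
  (* The chosen component is [v]: two candidates differ by an element of both [Vs] and the domain of
     [A]. *)
  have -> : xget 0 (fun v' => Vs v' /\ dom A (f + v - v')) = v.
    apply: xget_unique; first by rewrite addrK.
    move=> v' [Vv' Afv]; apply/eqP; rewrite -subr_eq0; apply/eqP.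
    apply: VsA; first exact: subspaceB.
    have := subspaceB A_lin.1 Af Afv.
    by rewrite opprB addrCA opprD addNKr.
  have [Atsf <-] := ext f Af.
  by rewrite (adjointD hilb adj dAt) //; exact: VsAts.
split=> [diss v Vv|bound x].
  have SKD := image_subspace SK_lin sD
    (fun f Df => let: And3 SKf _ _ := krein_factor krein Df in SKf).
  have wR : in_closure ip (fun y => exists2 f, D f & act SK f = y) (w v).
    have cSKD := closure_subspace ipP SKD; have [SKv LvR] := VsL v Vv.
    have [_ Rg _] := inv_sqrt_range hilb SF_sa SF_lin dSF invF LvR.
    have SKvR := krein_range_closure hilb (sD : subspace (dom (imag_part A At D)))
      dD krein SKv.
    have UgR := partial_iso_closure hilb SF_lin UP coreSF Rg.
    exact: subspaceB cSKD (subspaceZ _ cSKD SKvR) (subspaceZ _ cSKD UgR).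
  rewrite nsq_w; apply/ler_addgt0Pr => e e0.
  (* Choosing [f] in [D] with [SK f] close to [- w v / 2] makes the square in [form] smaller than
     [e]. *)
  have cl := subspaceZ (- real_complex R 2^-1) (closure_subspace ipP SKD) wR.
  have [_ [[f Df <-] lt]] := cl e e0.
  have := diss (f + v); rewrite actAVL ?form //; last exact: DA.
  move/(_ (ex_intro _ f (ex_intro _ v (conj (DA f Df) (conj Vv erefl))))).
  move: lt; rewrite scaleNr -opprD (nsqN ipP) addrC; lra.
move=> [f [v [Af [Vv ->]]]]; rewrite actAVL // (Im_ip ipP).
(* [form] is available on [D] only; a general [f] is reached in graph norm, as [D] is a core of
   [A]. *)
have [u [Du uf Au]] := core_seq hilb coreA Af.
apply: (cvg_r_ge ipP (cvgZ ipP _ (cvgD ipP uf (cvg_cst ipP v)))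
  (cvgD ipP (cvgD ipP Au (cvg_cst ipP _)) (cvg_cst ipP _))) => n.
rewrite -(Im_ip ipP) form // -addrA addr_ge0 ?nsq_ge0 //.
by rewrite addrC subr_ge0 -nsq_w; exact: bound.
Qed.
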